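(* For $t_2>t_1\ge t_0\ge 1$, define $\mathbf{P}=\mathbf{\Phi}(t_2,t_1+1)$, $\mathbf{G}=\mathbf{\Phi}(t_1,t_0)$ and $\mathbf{F}=\mathbf{\Phi}(t_2,t_0)$. Then $$\delta_{t_1+1}(\mathbf{F})\le \left(1-\eta_{t_1+1}(\mathbf{P})\right)\delta_{t_1+1}(\mathbf{G}).$$
   Context: $G(\mathcal{V},\mathcal{E})$ is a finite directed graph without self-loops, $\mathcal{V}=\{1,\dots,n\}$; $\mathcal{I}_i$ is the set of incoming neighbors of $i$; $f\ge 0$ is an integer with $|\mathcal{I}_i|\ge f$ for all $i$. At most $f$ agents (nodes) crash. $\mathcal{N}[t]\subseteq\mathcal{V}$ is the set of agents that have not crashed by the beginning of iteration $t\ge 1$, and $\bar{\mathcal{N}}[t]=\mathcal{N}[t+1]\subseteq\mathcal{N}[t]$ the set of those that have not crashed by the end of iteration $t$; $\mathcal{N}=\bigcap_{t\ge1}\mathcal{N}[t]$ satisfies $|\mathcal{V}\setminus\mathcal{N}|\le f$. For $i\in\bar{\mathcal{N}}[t]$, $\mathcal{R}_i[t]\subseteq\mathcal{I}_i\cap\mathcal{N}[t]$ is a set with $|\mathcal{R}_i[t]|=|\mathcal{I}_i|-f$ (the agents from which $i$ receives messages in iteration $t$); otherwise arbitrary. For $t\ge1$ the $n\times n$ row-stochastic matrix $\mathbf{A}[t]$ is defined by: for $i\in\bar{\mathcal{N}}[t]$, $\mathbf{A}_{ij}[t]=\frac{1}{|\mathcal{I}_i|-f+1}$ if $j\in\mathcal{R}_i[t]\cup\{i\}$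 and $0$ otherwise; for $i\notin\bar{\mathcal{N}}[t]$, $\mathbf{A}_{ii}[t]=1$ and $\mathbf{A}_{ij}[t]=0$ for $j\ne i$. For $t'\ge t\ge 1$, $\mathbf{\Phi}(t',t)=\mathbf{A}[t']\mathbf{A}[t'-1]\cdots\mathbf{A}[t]$. For $r\ge1$ and an $n\times n$ matrix $\mathbf{M}$ of the form $\mathbf{\Phi}(t',t)$ define $$\delta_{r}(\mathbf{M})=\max_{j\in\mathcal{V}}\max_{i,i'\in\mathcal{N}[r]}\left|\mathbf{M}_{ij}-\mathbf{M}_{i'j}\right|,\qquad \eta_{r}(\mathbf{M})=\min_{i,i'\in\mathcal{N}[r]}\sum_{j\in\mathcal{V}}\min\{\mathbf{M}_{ij},\mathbf{M}_{i'j}\}.$$ *)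

(* Defs.v *)
From mathcomp Require Import all_boot all_order all_algebra.
Set Implicit Arguments.
Unset Strict Implicit.
Unset Printing Implicit Defensive.
Import Order.TTheory GRing.Theory Num.Theory.
Local Open Scope ring_scope.

(* Maximum and minimum of F over a nonempty A. The big operator is seeded with
   one of the values of F, so nothing outside F @: A is compared; for empty A
   both are 0. *)
Definition fin_max (R : realFieldType) (I : finType) (A : {set I}) (F : I -> R) : R :=
  let s := [seq F x | x in A] in \big[Num.max/head 0 s]_(y <- s) y.

Definition fin_min (R : realFieldType) (I : finType) (A : {set I}) (F : I -> R) : R :=
  let s := [seq F x | x in A] in \big[Num.min/head 0 s]_(y <- s) y.

Lemma fin_max_spec (R : realFieldType) (I : finType) (A : {set I}) (F : I -> R) :
  A != set0 ->
  (exists2 x, x \in A & fin_max A F = F x) /\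
  (forall x, x \in A -> F x <= fin_max A F).
Proof.
case/set0Pn=> x0 Ax0; rewrite /fin_max; set s := [seq F x | x in A].
have s0 : head 0 s \in s.
  have: F x0 \in s by apply/imageP; exists x0.
  by case: s => //= a s' _; rewrite mem_head.
split; last by move=> x Ax; apply: le_bigmax_seq => //; apply/imageP; exists x.
suff /imageP[x Ax ->] : \big[Num.max/head 0 s]_(y <- s) y \in s by exists x.
rewrite big_seq; elim/big_ind: _ => // a b sa sb.
by rewrite /Order.max; case: ifP.
Qed.

Lemma fin_min_spec (R : realFieldType) (I : finType) (A : {set I}) (F : I -> R) :
  A != set0 ->
  (exists2 x, x \in A & fin_min A F = F x) /\
  (forall x, x \in A -> fin_min A F <= F x).
Proof.
case/set0Pn=> x0 Ax0; rewrite /fin_min; set s := [seq F x | x in A].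
have s0 : head 0 s \in s.
  have: F x0 \in s by apply/imageP; exists x0.
  by case: s => //= a s' _; rewrite mem_head.
split; last by move=> x Ax; apply: ge_bigmin_seq => //; apply/imageP; exists x.
suff /imageP[x Ax ->] : \big[Num.min/head 0 s]_(y <- s) y \in s by exists x.
rewrite big_seq; elim/big_ind: _ => // a b sa sb.
by rewrite /Order.min; case: ifP.
Qed.

(* e j i means that there is an edge from j to i. *)
Definition in_nbrs (n : nat) (e : rel 'I_n) (i : 'I_n) : {set 'I_n} :=
  [set j | e j i].

(* N t is the set of agents alive at the beginning of iteration t, so that
   N t.+1 is the set of agents alive at its end; Rcv t i is the set of agents
   from which i receives messages in iteration t. *)
Definition A_mx (R : realFieldType) (n f : nat) (e : rel 'I_n)
    (N : nat -> {set 'I_n}) (Rcv : nat -> 'I_n -> {set 'I_n}) (t : nat) : 'M[R]_n :=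
  \matrix_(i, j)
    if i \in N t.+1 then
      if j \in Rcv t i :|: [set i] then 1 / (#|in_nbrs e i| - f + 1)%N%:R else 0
    else if j == i then 1 else 0.

(* Backward product: the factor of the latest iteration is leftmost. *)
Definition Phi (R : realFieldType) (n f : nat) (e : rel 'I_n)
    (N : nat -> {set 'I_n}) (Rcv : nat -> 'I_n -> {set 'I_n}) (t' t : nat) : 'M[R]_n :=
  \big[mulmx/1%:M]_(s <- rev (index_iota t t'.+1)) A_mx R f e N Rcv s.

Definition delta (R : realFieldType) (n : nat) (N : nat -> {set 'I_n}) (r : nat)
    (M : 'M[R]_n) : R :=
  fin_max [set: 'I_n] (fun j =>
    fin_max (setX (N r) (N r)) (fun p => `|M p.1 j - M p.2 j|)).

Definition eta (R : realFieldType) (n : nat) (N : nat -> {set 'I_n}) (r : nat)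
    (M : 'M[R]_n) : R :=
  fin_min (setX (N r) (N r)) (fun p => \sum_j Num.min (M p.1 j) (M p.2 j)).

(* Main.v *)
(* Rows of P indexed by agents of N[t1+1] are probability vectors supported in
   N[t1+1]. Removing the common part min(P_ik, P_i'k) of two such rows leaves
   two nonnegative vectors of equal mass w <= 1 - eta(P); so the entries of
   F = P G in rows i and i' differ by at most w times the oscillation over
   N[t1+1] of a column of G. *)
Require Import Defs.
From mathcomp Require Import all_boot all_order all_algebra.
Set Implicit Arguments.
Unset Strict Implicit.
Unset Printing Implicit Defensive.
Import Order.TTheory GRing.Theory Num.Theory.
Local Open Scope ring_scope.

Lemma fin_max_set0 (R : realFieldType) (I : finType) (F : I -> R) :
  fin_max set0 F = 0.
Proof. by rewrite /fin_max /image_mem enum_set0 big_nil. Qed.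

Lemma fin_max_le (R : realFieldType) (I : finType) (A : {set I}) (F : I -> R) (c : R) :
  A != set0 -> (forall x, x \in A -> F x <= c) -> fin_max A F <= c.
Proof. by move=> A0 Fc; have [[x Ax ->] _] := fin_max_spec F A0; apply: Fc. Qed.

Section Delta.
Context {R : realFieldType} {n : nat} {N : nat -> {set 'I_n}} {r : nat}.
Implicit Types M P G : 'M[R]_n.

(** Settles the case of empty [N r] in [delta_mulmx]: each inner maximum takes its default 0, so
    both sides of the inequality are 0. *)
Lemma delta_set0 M : N r = set0 -> delta N r M = 0.
Proof.
move=> Nr0; rewrite /delta /fin_max.
have E j : fin_max (setX (N r) (N r)) (fun p => `|M p.1 j - M p.2 j|) = 0.
  suff -> : setX (N r) (N r) = set0 by rewrite fin_max_set0.
  by apply/setP=> -[i i']; rewrite !inE Nr0 !inE.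
rewrite -/(fin_max [set: 'I_n] _).
have [T0|T0] := eqVneq [set: 'I_n] set0; first by rewrite T0 fin_max_set0.
by have [[j _ ->] _] := fin_max_spec
  (fun j => fin_max (setX (N r) (N r)) (fun p => `|M p.1 j - M p.2 j|)) T0.
Qed.

Lemma ler_delta M i i' j : i \in N r -> i' \in N r ->
  `|M i j - M i' j| <= delta N r M.
Proof.
move=> Ni Ni'.
have pX : (i, i') \in setX (N r) (N r) by rewrite inE Ni.
have X0 : setX (N r) (N r) != set0 by apply/set0Pn; exists (i, i').
have T0 : [set: 'I_n] != set0 by apply/set0Pn; exists i.
have [_ /(_ _ pX)/=le1] := fin_max_spec (fun p => `|M p.1 j - M p.2 j|) X0.
by apply: le_trans le1 _; have [_ ->] := fin_max_spec
  (fun j => fin_max (setX (N r) (N r)) (fun p => `|M p.1 j - M p.2 j|)) T0.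
Qed.

Lemma delta_le M (c : R) : N r != set0 ->
  (forall i i' j, i \in N r -> i' \in N r -> `|M i j - M i' j| <= c) ->
  delta N r M <= c.
Proof.
case/set0Pn=> k Nk Mc; apply: fin_max_le => [|j _].
  by apply/set0Pn; exists k.
apply: fin_max_le => [|[i i'] /setXP[]]; last exact: Mc.
by apply/set0Pn; exists (k, k); rewrite inE Nk.
Qed.

Lemma eta_le M i i' : i \in N r -> i' \in N r ->
  eta N r M <= \sum_j Num.min (M i j) (M i' j).
Proof.
move=> Ni Ni'.
have pX : (i, i') \in setX (N r) (N r) by rewrite inE Ni.
have X0 : setX (N r) (N r) != set0 by apply/set0Pn; exists (i, i').
by have [_ /(_ _ pX)] :=
  fin_min_spec (fun p => \sum_j Num.min (M p.1 j) (M p.2 j)) X0.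
Qed.

End Delta.

Definition row_stochastic (R : realFieldType) (n : nat) (M : 'M[R]_n) : Prop :=
  (forall i j, 0 <= M i j) /\ (forall i, \sum_j M i j = 1).

(** Rows outside [S] are left free. Vanishing of the block with rows in [S] and columns outside [S]
    is a block triangular shape, hence stable under products. *)
Definition supported_on (R : realFieldType) (n : nat) (S : {set 'I_n})
    (M : 'M[R]_n) : Prop :=
  forall i j, i \in S -> j \notin S -> M i j = 0.

Lemma row_stochastic1 (R : realFieldType) (n : nat) :
  row_stochastic (1%:M : 'M[R]_n).
Proof.
split=> [i j|i]; first by rewrite !mxE ler0n.
rewrite (bigD1 i) //= big1 => [|j ji]; rewrite !mxE ?eqxx ?addr0 //.
by rewrite eq_sym (negbTE ji).
Qed.

Lemma row_stochasticM (R : realFieldType) (n : nat) (M M' : 'M[R]_n) :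
  row_stochastic M -> row_stochastic M' -> row_stochastic (M *m M').
Proof.
move=> [M0 M1] [M'0 M'1]; split=> [i j|i].
  by rewrite mxE sumr_ge0 // => k _; rewrite mulr_ge0.
under eq_bigr => j _ do rewrite mxE.
rewrite exchange_big /= -[RHS](M1 i); apply: eq_bigr => k _.
by rewrite -mulr_sumr M'1 mulr1.
Qed.

Lemma supported_on1 (R : realFieldType) (n : nat) (S : {set 'I_n}) :
  supported_on S (1%:M : 'M[R]_n).
Proof.
move=> i j iS jS; rewrite !mxE; case: eqP => // ij.
by rewrite -ij iS in jS.
Qed.

Lemma supported_onM (R : realFieldType) (n : nat) (S : {set 'I_n}) (M M' : 'M[R]_n) :
  supported_on S M -> supported_on S M' -> supported_on S (M *m M').
Proof.
move=> SM SM' i j iS jS; rewrite mxE big1 // => k _.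
have [kS|kS] := boolP (k \in S); first by rewrite (SM' k j) ?mulr0.
by rewrite (SM i k) ?mul0r.
Qed.

(** The weights need not sum to 1, so that the bounds apply to what is left of a stochastic row
    after a part is removed. *)
Lemma weighted_sum_bounds (R : realFieldType) (I : finType) (S : {set I})
    (a g : I -> R) (lo hi : R) :
  (forall k, 0 <= a k) -> (forall k, k \notin S -> a k = 0) ->
  (forall k, k \in S -> lo <= g k <= hi) ->
  (\sum_k a k) * lo <= \sum_k a k * g k <= (\sum_k a k) * hi.
Proof.
move=> a0 aS gS; rewrite !mulr_suml.
apply/andP; split; apply: ler_sum => k _.
  have [/gS/andP[lo_g _]|/aS ->] := boolP (k \in S); last by rewrite !mul0r.
  by rewrite ler_wpM2l.
have [/gS/andP[_ g_hi]|/aS ->] := boolP (k \in S); last by rewrite !mul0r.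
by rewrite ler_wpM2l.
Qed.

Lemma delta_mulmx (R : realFieldType) (n : nat) (N : nat -> {set 'I_n}) (r : nat)
    (P G : 'M[R]_n) :
  row_stochastic P -> supported_on (N r) P ->
  delta N r (P *m G) <= (1 - eta N r P) * delta N r G.
Proof.
move=> [P0 P1] SP.
have [Nr0|Nr0] := eqVneq (N r) set0; first by rewrite !delta_set0 // mulr0.
apply: delta_le => // i i' j Ni Ni'.
(* Rows [kM] and [km] of [N r] attain the extremes of column [j] of [G], so their gap is one of the
   differences bounded by [delta]. *)
have [[kM SkM hiE] hiP] := fin_max_spec (G^~ j) Nr0.
have [[km Skm loE] loP] := fin_min_spec (G^~ j) Nr0.
rewrite hiE in hiP; rewrite loE in loP.
pose m k := Num.min (P i k) (P i' k); pose w := 1 - \sum_k m k.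
(* As every row of [P] sums to 1, the mass [w] is independent of [l]; rows [i] and [i'] thus get the
   same interval. *)
have excess l : l \in N r -> (forall k, m k <= P l k) ->
    (forall k, k \notin N r -> m k = 0) -> 0 <= w /\
    w * G km j <= \sum_k (P l k - m k) * G k j <= w * G kM j.
  move=> Nl ml mS.
  have wE : w = \sum_k (P l k - m k) by rewrite sumrB P1.
  split; first by rewrite wE sumr_ge0 // => k _; rewrite subr_ge0.
  rewrite wE; apply: (@weighted_sum_bounds _ _ (N r)) => k.
  - by rewrite subr_ge0.
  - by move=> kS; rewrite (SP l) // mS // subr0.
  - by move=> kS; rewrite loP // hiP.
have mS k : k \notin N r -> m k = 0.
  by move=> kS; rewrite /m !SP // minxx.
have [|w0 /andP[lo1 hi1]] := excess i Ni _ mS.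
  by move=> k; rewrite ge_min lexx.
have [|_ /andP[lo2 hi2]] := excess i' Ni' _ mS.
  by move=> k; rewrite ge_min lexx orbT.
(* The contributions of [m] to the two rows cancel. *)
have -> : (P *m G) i j - (P *m G) i' j =
    \sum_k (P i k - m k) * G k j - \sum_k (P i' k - m k) * G k j.
  by rewrite !mxE -!sumrB; apply: eq_bigr => k _; rewrite !mulrBl opprB addrA subrK.
(* Both sums lie in an interval of length [w * (G kM j - G km j)]. *)
apply: (@le_trans _ _ (w * (G kM j - G km j))).
  by rewrite ler_norml mulrBr opprB !lerB.
apply: ler_pM => //; first by rewrite subr_ge0 hiP.
  by rewrite lerB // eta_le.
by apply: le_trans (ler_norm _) _; apply: ler_delta.
Qed.

(** The row of an alive agent has equal entries on [Rcv t i] and at [i]; since [i] is not in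
    [Rcv t i], their number is exactly the denominator. Any other row is an identity row. *)
Lemma A_mx_row_stochastic (R : realFieldType) (n f : nat) (e : rel 'I_n)
    (N : nat -> {set 'I_n}) (Rcv : nat -> 'I_n -> {set 'I_n}) (t : nat) :
  (forall i, i \in N t.+1 -> i \notin Rcv t i) ->
  (forall i, i \in N t.+1 -> #|Rcv t i| = (#|in_nbrs e i| - f)%N) ->
  row_stochastic (A_mx R f e N Rcv t).
Proof.
move=> Rcv_self Rcv_card; split=> [i j|i].
  rewrite mxE; case: ifP => _; case: ifP => _ //.
  by rewrite divr_ge0 ?ler0n.
under eq_bigr => j _ do rewrite mxE.
have [Ni|_] := boolP (i \in N t.+1); last by rewrite -big_mkcond big_pred1_eq.
rewrite -big_mkcond sumr_const setUC cardsU1 Rcv_self // Rcv_card //.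
by rewrite addn1 add1n -[LHS]mulr_natr div1r mulVf // pnatr_eq0.
Qed.

Lemma A_mx_supported_on (R : realFieldType) (n f : nat) (e : rel 'I_n)
    (N : nat -> {set 'I_n}) (Rcv : nat -> 'I_n -> {set 'I_n}) (t : nat) (S : {set 'I_n}) :
  (forall i, i \in N t.+1 -> Rcv t i \subset S) ->
  supported_on S (A_mx R f e N Rcv t).
Proof.
move=> Rcv_S i j iS jS; rewrite mxE.
have ji : (j == i) = false by apply: contraNF jS => /eqP->.
case: ifP => [/Rcv_S/subsetP RS|_]; rewrite ?ji //.
by rewrite !inE ji orbF; case: ifP => // /RS; rewrite (negbTE jS).
Qed.

(** Only factors with index at least [t] occur, so properties of the iterations from [t] on pass to
    the whole product. *)
Lemma Phi_ind (R : realFieldType) (n f : nat) (e : rel 'I_n)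
    (N : nat -> {set 'I_n}) (Rcv : nat -> 'I_n -> {set 'I_n}) (t' t : nat)
    (K : 'M[R]_n -> Prop) :
  K 1%:M -> (forall M M', K M -> K M' -> K (M *m M')) ->
  (forall s, (t <= s)%N -> K (A_mx R f e N Rcv s)) ->
  K (Phi R f e N Rcv t' t).
Proof.
move=> K1 KM KA; rewrite /Phi big_seq; apply: big_ind => // s.
by rewrite mem_rev mem_index_iota => /andP[/KA].
Qed.

Lemma Phi_split (R : realFieldType) (n f : nat) (e : rel 'I_n)
    (N : nat -> {set 'I_n}) (Rcv : nat -> 'I_n -> {set 'I_n}) (t0 t1 t2 : nat) :
  (t0 <= t1)%N -> (t1 < t2)%N ->
  Phi R f e N Rcv t2 t0 = Phi R f e N Rcv t2 t1.+1 *m Phi R f e N Rcv t1 t0.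
Proof.
move=> t01 t12; rewrite /Phi /index_iota.
have -> : (t2.+1 - t0 = (t1.+1 - t0) + (t2.+1 - t1.+1))%N.
  by rewrite [RHS]addnC addnBA ?subnK // ltnW // ltnS ltnW.
rewrite iotaD subnKC ?rev_cat; last exact: ltnW.
(* Reversal has put the later iterations first. On square matrices [mulmx] and [1%:M] are the
   product and unit of the matrix ring, which supply the monoid law. *)
exact: (@big_cat 'M[R]_n 1 *%R).
Qed.

Theorem lemma2 (R : realFieldType) (n f : nat) (e : rel 'I_n)
    (N : nat -> {set 'I_n}) (Ninf : {set 'I_n}) (Rcv : nat -> 'I_n -> {set 'I_n})
    (e_loopless : forall i, ~~ e i i)
    (indeg_ge : forall i, (f <= #|in_nbrs e i|)%N)
    (N_decr : forall t, (1 <= t)%N -> N t.+1 \subset N t)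
    (NinfP : forall i, i \in Ninf <-> (forall t, (1 <= t)%N -> i \in N t))
    (crash_le : (#|[set: 'I_n] :\: Ninf| <= f)%N)
    (Rcv_sub : forall t i, (1 <= t)%N -> i \in N t.+1 ->
       Rcv t i \subset in_nbrs e i :&: N t)
    (Rcv_card : forall t i, (1 <= t)%N -> i \in N t.+1 ->
       #|Rcv t i| = (#|in_nbrs e i| - f)%N)
    (t0 t1 t2 : nat) (t0_ge1 : (1 <= t0)%N) (t0_le : (t0 <= t1)%N) (t1_lt : (t1 < t2)%N) :
  let P := Phi R f e N Rcv t2 t1.+1 in
  let G := Phi R f e N Rcv t1 t0 in
  let F := Phi R f e N Rcv t2 t0 in
  delta N t1.+1 F <= (1 - eta N t1.+1 P) * delta N t1.+1 G.
Proof.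
cbv zeta.
(* Senders in an iteration [s] after [t1] are in [N s], hence in [N t1.+1]; this gives the support
   of [P]. *)
have Nmono s : (t1 < s)%N -> N s \subset N t1.+1.
  move=> t1s; rewrite -(subnKC t1s); elim: (s - t1.+1)%N => [|k IHk].
    by rewrite addn0.
  by rewrite addnS; apply: subset_trans (N_decr _ _) IHk.
rewrite (Phi_split _ _ _ _ _ t0_le t1_lt); apply: delta_mulmx.
- apply: Phi_ind; [exact: row_stochastic1 | exact: row_stochasticM |].
  move=> s t1s; have s1 : (1 <= s)%N by apply: leq_trans t1s.
  apply: A_mx_row_stochastic => i Ni; last exact: Rcv_card.
  (* Senders are in-neighbors, so a message from [i] to itself would require a self-loop. *)
  apply: contra (e_loopless i) => /(subsetP (Rcv_sub _ _ s1 Ni)).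
  by rewrite !inE => /andP[].
- apply: Phi_ind; [exact: supported_on1 | exact: supported_onM |].
  move=> s t1s; have s1 : (1 <= s)%N by apply: leq_trans t1s.
  apply: A_mx_supported_on => i Ni.
  apply: subset_trans (Rcv_sub _ _ s1 Ni) _.
  by apply: subset_trans (subsetIr _ _) (Nmono _ t1s).
Qed.
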